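(* Consider the uncertain linear system $x_{k+1}=A(\theta^* )x_k+B(\theta^* )u_k+w_k$ with unknown constant parameter $\theta^*\in\Theta$ and disturbances $w_k\in\mathbb{W}$, the assumptions (A1) (perfect state measurement), (A2) (rank conditions), (A3) (robustly stabilizing gain $K$) and (A4) (contractivity of $\mathbb{X}_0$), the optimization problem $\mathrm{P}_k$ and the dual adaptive MPC algorithm, all as defined in the context. Suppose (A1)--(A4) hold and that $\mathrm{P}_0$ (the problem at the initial time step $k=0$) is feasible. Then, for every $\theta^*\in\Theta$ and every disturbance sequence with $w_k\in\mathbb{W}$ for all $k$, the closed-loop system obtained by applying the dual adaptive MPC algorithm has the following properties: the optimization problem $\mathrm{P}_k$ is feasible for all $k\in\{1,\dots,T\}$, and the closed-loop trajectories satisfy the constraints $Fx_k+Gu_k\le\mathbf{1}$ for all $k\in\{0,\dots,T\}$.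
   Context: All vector/matrix inequalities are elementwise; $\mathbf 1$ is the all-ones vector; $[M]_i$ is the $i$-th row of $M$ (or $i$-th entry of a vector); $\otimes$ is the Kronecker product; $\mathbb{N}_a^b=\{a,a+1,\dots,b\}$; ''$a_{l|k}$'' is a quantity for time $k+l$ computed at time $k$. **System.** $x_{k}\in\mathbb{R}^n$, $u_k\in\mathbb{R}^m$, $w_k\in\mathbb{R}^n$; $A(\theta)=A_0+\sum_{i=1}^pA_i[\theta]_i$, $B(\theta)=B_0+\sum_{i=1}^pB_i[\theta]_i$ with known matrices $A_i,B_i$; $\theta^*\in\Theta=\{\theta\in\mathbb{R}^p: H_\theta\theta\le h_\theta\}$, bounded, $H_\theta\in\mathbb{R}^{n_\theta\times p}$; $\mathbb{W}=\{w\in\mathbb{R}^n:H_ww\le h_w\}$, nonempty and bounded; output $y=Cx\in\mathbb{R}^{n_y}$; constraint set $\mathbb{Z}=\{(x,u):Fx+Gu\le\mathbf 1\}$, compact, with $F\in\mathbb{R}^{n_c\times n}$, $G\in\mathbb{R}^{n_c\times m}$. $T$ is the control horizon, $N$ the prediction horizon, $N_\theta\in\mathbb{N}_2^N$ the lookahead horizon, and $r_t\in\mathbb{R}^{n_y}$ a known reference given for all times $t$ needed. For $x\in\mathbb{R}^n,u\in\mathbb{R}^m$ let $D(x,u)=[A_1x+B_1u,\dots,A_px+B_pu]\in\mathbb{R}^{n\times p}$. **Offline data.** $K\in\mathbb{R}^{m\times n}$ is a feedback gain; $\mathbb{X}_0=\{x\in\mathbb{R}^n:H_xx\le\mathbf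 1\}=\mathrm{co}\{x^1,\dots,x^q\}$ is a bounded polytope, $H_x\in\mathbb{R}^{n_x\times n}$; $[\bar f]_i=\max_{x\in\mathbb{X}_0}[F+GK]_ix$ for $i\in\mathbb{N}_1^{n_c}$; $[\bar w]_i=\max_{w\in\mathbb{W}}[H_x]_iw$ for $i\in\mathbb{N}_1^{n_x}$; $\bar{\bar f}=\max_i[\bar f]_i$. **Assumptions.** (A1) The state $x_k$ is perfectly measured at each time step. (A2) $m\ge n_y$ and, for all $\theta\in\Theta$, $$\mathrm{rank}\begin{bmatrix}A_{\rm st}(\theta)&B_{\rm st}(\theta)\\C_{\rm st}&0\end{bmatrix}=N(n+n_y),\qquad \mathrm{rank}\begin{bmatrix}A(\theta)-I_n&B(\theta)\\C&0\end{bmatrix}=n+n_y,$$ where $A_{\rm st}(\theta)\in\mathbb{R}^{Nn\times Nn}$ is the block matrix with $N$ diagonal blocks $A(\theta)$, blocks $-I_n$ on the first block superdiagonal and zeros elsewhere, $B_{\rm st}(\theta)=I_N\otimes B(\theta)$, $C_{\rm st}=I_N\otimes C$. (A3) $A(\theta)+B(\theta)K$ is asymptotically stable for every $\theta\in\Theta$. (A4) There is $\lambda_c\in[0,1)$ with $H_x(A(\theta)x+B(\theta)Kx)\le\lambda_c\mathbf 1$ for all $\theta\in\Theta$, $x\in\mathbb{X}_0$, and $\lambda_c\mathbf 1\le\mathbf 1-\bar{\bar f}\,\bar w$. **Parameter identification.** $\Theta_0=\Theta$, i.e. $h_{\theta_0}=h_\theta$, and $\Theta_k=\{\theta:H_\theta\theta\le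 h_{\theta_k}\}$. For $k\ge1$ and a window length $\tau\ge 1$, let $\Delta_k=\{\theta: -H_wD(x_i,u_i)\theta\le h_w+H_w(A_0x_i+B_0u_i-x_{i+1}),\ \forall i\in\mathbb{N}_{\max(0,k-\tau)}^{k-1}\}$ and $[h_{\theta_k}]_i=\max\{[H_\theta]_i\theta:\theta\in\Theta_{k-1}\cap\Delta_k\}$, $i\in\mathbb{N}_1^{n_\theta}$. The estimate $\bar\theta_0\in\Theta$ is an initial guess and, for $k\ge1$, $\bar\theta_k$ is the optimal $\theta_c$ of $$\max_{r_c\ge0,\,\theta_c}\ r_c-\mu\|\theta_c-\bar\theta_{k-1}\|_2^2\quad\text{s.t. } [H_\theta]_i\theta_c+r_c\|[H_\theta]_i\|_2\le[h_{\theta_k}]_i\ \ \forall i\in\mathbb{N}_1^{n_\theta},$$ with fixed $\mu>0$. **Optimization problem $\mathrm{P}_k$** (data: $x_k$, $h_{\theta_k}$, $\bar\theta_k$, references $r_k,\dots,r_{k+N}$). Decision variables: $z_{l|k},\hat z_{l|k}\in\mathbb{R}^n$ and $\alpha_{l|k},\hat\alpha_{l|k}\in\mathbb{R}$ for $l\in\mathbb{N}_0^N$; $v_{l|k}\in\mathbb{R}^m$ for $l\in\mathbb{N}_0^{N-1}$; $\bar x_{l|k}\in\mathbb{R}^n$, $\bar u_{l|k}\in\mathbb{R}^m$ for $l\in\mathbb{N}_0^N$; $\tilde x_{N|k}\in\mathbb{R}^n$, $\tilde u_{N|k}\in\mathbb{R}^m$, $\tilde\alpha_{N|k}\in\mathbb{R}$;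 and matrices $\Lambda^j_{l|k}\in\mathbb{R}^{n_x\times n_\theta}$, $\hat\Lambda^j_{l|k}$ (with $n_x$ rows and as many columns as $\hat H_{l|k}$ below has rows) for $l\in\mathbb{N}_0^{N-1}$, $j\in\mathbb{N}_1^q$, and $\tilde\Lambda^j_{N|k}\in\mathbb{R}^{n_x\times n_\theta}$, $j\in\mathbb{N}_1^q$. Abbreviations: - $x^j_{l|k}=z_{l|k}+\alpha_{l|k}x^j$, $u^j_{l|k}=K(x^j_{l|k}-\bar x_{l|k})+v_{l|k}$, $D^j_{l|k}=D(x^j_{l|k},u^j_{l|k})$, $d^j_{l|k}=A_0x^j_{l|k}+B_0u^j_{l|k}-z_{l+1|k}$; - $\hat x^j_{l|k}=\hat z_{l|k}+\hat\alpha_{l|k}x^j$, $\hat u^j_{l|k}=K(\hat x^j_{l|k}-\bar x_{l|k})+v_{l|k}$, $\hat D^j_{l|k}=D(\hat x^j_{l|k},\hat u^j_{l|k})$, $\hat d^j_{l|k}=A_0\hat x^j_{l|k}+B_0\hat u^j_{l|k}-\hat z_{l+1|k}$; - $\tilde x^j_{N|k}=\tilde x_{N|k}+\tilde\alpha_{N|k}x^j$, $\tilde u^j_{N|k}=K(\tilde x^j_{N|k}-\tilde x_{N|k})+\tilde u_{N|k}$, $D^j_{N|k}=D(\tilde x^j_{N|k},\tilde u^j_{N|k})$, $d^j_{N|k}=A_0\tilde x^j_{N|k}+B_0\tilde u^j_{N|k}-\tilde x_{N|k}$; - predicted measurements: $\hat x_{0|k}=x_k$, $\hat u_{l|k}=K(\hat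 x_{l|k}-\bar x_{l|k})+v_{l|k}$, $\hat x_{l+1|k}=A(\bar\theta_k)\hat x_{l|k}+B(\bar\theta_k)\hat u_{l|k}$; - predicted parameter sets $\{\theta:\hat H_{l|k}\theta\le\hat h_{l|k}\}$, for $l\in\mathbb{N}_0^{N_\theta}$, where $\hat H_{l|k}$ stacks $H_\theta$ and $-H_wD(\hat x_{t|k},\hat u_{t|k})$, $t=0,\dots,l-1$, and $\hat h_{l|k}$ stacks $h_{\theta_k}$ and $h_w+H_w(A_0\hat x_{t|k}+B_0\hat u_{t|k}-\hat x_{t+1|k})$, $t=0,\dots,l-1$; for $l>N_\theta$ set $\hat H_{l|k}=\hat H_{N_\theta|k}$, $\hat h_{l|k}=\hat h_{N_\theta|k}$. The constraints are, for all $j\in\mathbb{N}_1^q$, $l\in\mathbb{N}_0^{N-1}$: 1. $(F+GK)z_{l|k}+Gv_{l|k}-GK\bar x_{l|k}+\alpha_{l|k}\bar f\le\mathbf 1$; 2. $-H_xz_{0|k}-\alpha_{0|k}\mathbf 1\le-H_xx_k$; 3. $\Lambda^j_{l|k}h_{\theta_k}+H_xd^j_{l|k}-\alpha_{l+1|k}\mathbf 1\le-\bar w$ and $H_xD^j_{l|k}=\Lambda^j_{l|k}H_\theta$; 4. $-H_x\hat z_{0|k}-\hat\alpha_{0|k}\mathbf 1\le-H_xx_k$; 5. $\hat\Lambda^j_{l|k}\hat h_{l|k}+H_x\hat d^j_{l|k}-\hat\alpha_{l+1|k}\mathbf 1\le-\bar w$ and $H_x\hat D^j_{l|k}=\hat\Lambda^j_{l|k}\hat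 H_{l|k}$; 6. $A(\bar\theta_k)\bar x_{l|k}+B(\bar\theta_k)\bar u_{l|k}=\bar x_{l+1|k}$ and $C\bar x_{l|k}=r_{k+l}$; 7. $(A(\bar\theta_k)-I_n)\bar x_{N|k}+B(\bar\theta_k)\bar u_{N|k}=0$ and $C\bar x_{N|k}=r_{k+N}$; 8. $F\tilde x_{N|k}+G\tilde u_{N|k}+\tilde\alpha_{N|k}\bar f\le\mathbf 1$; 9. $\tilde\Lambda^j_{N|k}h_{\theta_k}+H_xd^j_{N|k}-\tilde\alpha_{N|k}\mathbf 1\le-\bar w$ and $H_xD^j_{N|k}=\tilde\Lambda^j_{N|k}H_\theta$; 10. $z_{N|k}=\tilde x_{N|k}$ and $\alpha_{N|k}\le\tilde\alpha_{N|k}$; 11. all $\alpha_{\cdot|k},\hat\alpha_{\cdot|k},\tilde\alpha_{N|k}\ge0$ and all $\Lambda^j_{l|k},\hat\Lambda^j_{l|k},\tilde\Lambda^j_{N|k}\ge0$ elementwise. The cost to be minimized is, with $\hat{\mathbb{X}}_{l|k}=\{\hat z_{l|k}\}\oplus\hat\alpha_{l|k}\mathbb{X}_0$ and positive definite weights $Q,R$, $$\sum_{l=0}^{N-1}\max_{x\in\hat{\mathbb{X}}_{l|k}}\big(\|Q(Cx-r_{k+l})\|_\infty+\|R(K(x-\bar x_{l|k})+v_{l|k}-\bar u_{l|k})\|_\infty\big)+\beta(k+N)\max_{x\in\hat{\mathbb{X}}_{N|k}}\big(\|Q(Cx-r_{k+N})\|_\infty+\|R(K(x-\bar x_{N|k})+\tilde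 u_{N|k}-\bar u_{N|k})\|_\infty\big),$$ where $\beta(t)=(1-\lambda_c^{T-t})/(1-\lambda_c)$ for $t\le T$ and $\beta(t)=0$ for $t>T$. **Dual adaptive MPC algorithm.** At each $k=0,1,\dots,T$: measure $x_k$; if $k=0$, set $h_{\theta_0}=h_\theta$ (hence $\Theta_0=\Theta$) and use the initial guess $\bar\theta_0\in\Theta$; if $k\ge1$, form the non-falsified set $\Delta_k$ from the measured states and applied inputs, compute $[h_{\theta_k}]_i=\max\{[H_\theta]_i\theta:\theta\in\Theta_{k-1}\cap\Delta_k\}$ for $i\in\mathbb{N}_1^{n_\theta}$ (hence $\Theta_k=\{\theta:H_\theta\theta\le h_{\theta_k}\}$), and compute $\bar\theta_k$ as the optimal $\theta_c$ of the program of maximizing $r_c-\mu\|\theta_c-\bar\theta_{k-1}\|_2^2$ over $r_c\ge0$ and $\theta_c$ subject to $[H_\theta]_i\theta_c+r_c\|[H_\theta]_i\|_2\le[h_{\theta_k}]_i$ for all $i\in\mathbb{N}_1^{n_\theta}$; solve $\mathrm{P}_k$, obtaining an optimal solution (an optimal solution is taken to exist whenever $\mathrm{P}_k$ is feasible); apply $u_k=K(x_k-\bar x_{0|k})+v_{0|k}$ with $\bar x_{0|k},v_{0|k}$ from that solution. *)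

(* Defs.v *)
From HB Require Import structures.
From mathcomp Require Import all_boot all_order all_algebra.
From mathcomp Require Import mxtens.
From mathcomp Require Import all_classical all_reals all_analysis.

Set Implicit Arguments.
Unset Strict Implicit.
Unset Printing Implicit Defensive.

Import Order.TTheory GRing.Theory Num.Theory.
Import numFieldNormedType.Exports.

Local Open Scope classical_set_scope.
Local Open Scope ring_scope.

(* On matrices, `|_| is the largest absolute value of an entry, so that on
   column vectors it is the infinity norm.  tensmx is the Kronecker product. *)

Definition lemx (R : realType) (a b : nat) (M P : 'M[R]_(a, b)) : Prop :=
  forall i j, M i j <= P i j.
Notation "M <=m P" := (lemx M P) (at level 70, no associativity) : ring_scope.

Definition ones (R : realType) (a : nat) : 'cV[R]_a := const_mx 1.
Arguments ones {R a}.

Definition norm2 (R : realType) (a b : nat) (v : 'M[R]_(a, b)) : R :=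
  Num.sqrt (\sum_i \sum_j v i j ^+ 2).

Definition is_max (R : realType) (S : set R) (M : R) : Prop :=
  S M /\ ubound S M.

Definition polyhedron (R : realType) (a b : nat) (H : 'M[R]_(a, b))
    (h : 'cV[R]_a) : set 'cV[R]_b :=
  [set v | H *m v <=m h].

Definition convex_hull (R : realType) (a q : nat) (v : 'I_q -> 'cV[R]_a) :
    set 'cV[R]_a :=
  [set x | exists c : 'I_q -> R,
     [/\ forall j, 0 <= c j, \sum_j c j = 1 & x = \sum_j c j *: v j]].

(* Symmetry of M is not required. *)
Definition positive_definite (R : realType) (a : nat) (M : 'M[R]_a) : Prop :=
  forall v : 'cV[R]_a, v != 0 -> 0 < (v^T *m M *m v) 0 0.

(* Asymptotic stability of the origin for x_(k+1) = M x_k: Lyapunov stability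
   and global attractivity. *)
Definition asymptotically_stable (R : realType) (a : nat) (M : 'M[R]_a) :
    Prop :=
  (forall e : R, 0 < e -> exists2 dl : R, 0 < dl &
     forall x : 'cV[R]_a, `|x| < dl -> forall k, `|iter k (mulmx M) x| < e) /\
  (forall x : 'cV[R]_a, iter k (mulmx M) x @[k --> \oo] --> (0 : 'cV[R]_a)).

(* The subscripts A_1, ..., A_p of the parametric matrices (and likewise for B)
   are shifted to 'I_p; A_0 and B_0 are the fields A0 and B0. *)
Record mpc_data (R : realType) := MpcData {
  dimx : nat;                                (* n *)
  dimu : nat;                                (* m *)
  dimp : nat;                                (* p *)
  dimy : nat;                                (* n_y *)
  rowsF : nat;                               (* n_c *)
  rowsHx : nat;                              (* n_x *)
  rowsHth : nat;                             (* n_theta *)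
  rowsHw : nat;
  nvert : nat;                               (* q *)
  ctrl_hor : nat;                            (* T *)
  pred_hor : nat;                            (* N *)
  look_hor : nat;                            (* N_theta *)
  window : nat;                              (* tau *)
  A0 : 'M[R]_dimx;
  Ap : 'I_dimp -> 'M[R]_dimx;
  B0 : 'M[R]_(dimx, dimu);
  Bp : 'I_dimp -> 'M[R]_(dimx, dimu);
  C : 'M[R]_(dimy, dimx);
  F : 'M[R]_(rowsF, dimx);
  G : 'M[R]_(rowsF, dimu);
  Hth : 'M[R]_(rowsHth, dimp);
  hth : 'cV[R]_rowsHth;
  Hw : 'M[R]_(rowsHw, dimx);
  hw : 'cV[R]_rowsHw;
  K : 'M[R]_(dimu, dimx);
  Hx : 'M[R]_(rowsHx, dimx);
  xvert : 'I_nvert -> 'cV[R]_dimx;           (* x^1, ..., x^q *)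
  fbar : 'cV[R]_rowsF;
  wbar : 'cV[R]_rowsHx;
  fbarbar : R;
  lambda_c : R;
  mu : R;
  Qw : 'M[R]_dimy;                           (* Q *)
  Rw : 'M[R]_dimu;                           (* R *)
  ref : nat -> 'cV[R]_dimy                   (* r *)
}.

Section Setup.
Context (R : realType) (d : mpc_data R).

Notation state := 'cV[R]_(dimx d).
Notation input := 'cV[R]_(dimu d).
Notation param := 'cV[R]_(dimp d).
Notation T := (ctrl_hor d).
Notation N := (pred_hor d).
Notation A0 := (A0 d).
Notation B0 := (B0 d).
Notation C := (C d).
Notation F := (F d).
Notation G := (G d).
Notation K := (K d).
Notation Hx := (Hx d).
Notation Hth := (Hth d).
Notation Hw := (Hw d).
Notation hw := (hw d).
Notation fbar := (fbar d).
Notation wbar := (wbar d).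
Notation xv := (@xvert R d).

Definition Amx (th : param) : 'M[R]_(dimx d) :=
  A0 + \sum_i th i 0 *: Ap i.

Definition Bmx (th : param) : 'M[R]_(dimx d, dimu d) :=
  B0 + \sum_i th i 0 *: Bp i.

Definition Dmx (x : state) (u : input) : 'M[R]_(dimx d, dimp d) :=
  \matrix_(i, j) (Ap j *m x + Bp j *m u) i 0.

Definition Theta : set param := polyhedron Hth (hth d).
Definition Wset : set state := polyhedron Hw hw.
Definition X0set : set state := polyhedron Hx ones.
Definition Zset : set (state * input) :=
  [set xu | F *m xu.1 + G *m xu.2 <=m ones].

Record standing_assumptions : Prop := StandingAssumptions {
  sa_horizons : (2 <= look_hor d <= N)%N;
  sa_window : (1 <= window d)%N;
  sa_Theta : bounded_set Theta;
  sa_W_nonempty : Wset !=set0;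
  sa_W : bounded_set Wset;
  sa_Z : compact Zset;
  sa_X0 : bounded_set X0set;
  sa_vertices : X0set = convex_hull xv;
  sa_fbar : forall i, is_max [set ((F + G *m K) *m x) i 0 | x in X0set]
                             (fbar i 0);
  sa_wbar : forall i, is_max [set (Hx *m w) i 0 | w in Wset] (wbar i 0);
  sa_fbarbar : is_max [set fbar i 0 | i in [set: 'I_(rowsF d)]] (fbarbar d);
  sa_mu : 0 < mu d;
  sa_Q : positive_definite (Qw d);
  sa_R : positive_definite (Rw d)
}.

Definition upshift (a : nat) : 'M[R]_a := \matrix_(i, j) (j == i.+1 :> nat)%:R.

(* Blocks A(th) on the diagonal and - I_n on the first block superdiagonal. *)
Definition Ast (th : param) : 'M[R]_(N * dimx d) :=
  tensmx (1%:M : 'M[R]_N) (Amx th) - tensmx (upshift N) (1%:M : 'M[R]_(dimx d)).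
Definition Bst (th : param) : 'M[R]_(N * dimx d, N * dimu d) :=
  tensmx (1%:M : 'M[R]_N) (Bmx th).
Definition Cst : 'M[R]_(N * dimy d, N * dimx d) := tensmx (1%:M : 'M[R]_N) C.

Definition rank_assumption : Prop :=
  (dimy d <= dimu d)%N /\
  forall th, Theta th ->
    \rank (block_mx (Ast th) (Bst th) Cst 0) = (N * (dimx d + dimy d))%N /\
    \rank (block_mx (Amx th - 1%:M) (Bmx th) C 0) = (dimx d + dimy d)%N.

Definition stability_assumption : Prop :=
  forall th, Theta th -> asymptotically_stable (Amx th + Bmx th *m K).

Definition contraction_assumption : Prop :=
  [/\ 0 <= lambda_c d < 1,
      forall th x, Theta th -> X0set x ->
        Hx *m (Amx th *m x + Bmx th *m (K *m x)) <=m lambda_c d *: ones &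
      lambda_c d *: ones <=m ones - fbarbar d *: wbar].

Definition Delta (x : nat -> state) (u : nat -> input) (k : nat) : set param :=
  [set th | forall i, (k - window d <= i < k)%N ->
     - (Hw *m Dmx (x i) (u i)) *m th
       <=m hw + Hw *m (A0 *m x i + B0 *m u i - x i.+1)].

Definition estimate_feasible (h : 'cV[R]_(rowsHth d)) (rc : R) (th : param) :
    Prop :=
  0 <= rc /\
  forall i, (Hth *m th) i 0 + rc * norm2 (row i Hth) <= h i 0.

Definition estimate_objective (thprev : param) (rc : R) (th : param) : R :=
  rc - mu d * norm2 (th - thprev) ^+ 2.

Definition estimate_optimal (h : 'cV[R]_(rowsHth d)) (thprev th : param) :
    Prop :=
  exists2 rc, estimate_feasible h rc th &
    forall rc' th', estimate_feasible h rc' th' ->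
      estimate_objective thprev rc' th' <= estimate_objective thprev rc th.

Definition rows_hat (l : nat) : nat :=
  (rowsHth d + \sum_(t < minn l (look_hor d)) rowsHw d)%N.

(* Families indexed by the prediction step l are total functions on nat; their
   values beyond the range of l in the problem enter neither the constraints
   nor the cost. *)
Record decision := Decision {
  z : nat -> state;
  zh : nat -> state;
  al : nat -> R;
  alh : nat -> R;
  v : nat -> input;
  xb : nat -> state;
  ub : nat -> input;
  xt : state;
  ut : input;
  alt : R;
  Lam : nat -> 'I_(nvert d) -> 'M[R]_(rowsHx d, rowsHth d);
  Lamh : forall l : nat, 'I_(nvert d) -> 'M[R]_(rowsHx d, rows_hat l);
  Lamt : 'I_(nvert d) -> 'M[R]_(rowsHx d, rowsHth d)
}.

Section Problem.
(* The data of the problem at time k: measured state, h_(theta_k) and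
   the estimate of the parameter. *)
Context (k : nat) (x : state) (h : 'cV[R]_(rowsHth d)) (thb : param).

Section Candidate.
Context (s : decision).

Definition xj (l : nat) (j : 'I_(nvert d)) : state := z s l + al s l *: xv j.
Definition uj (l : nat) (j : 'I_(nvert d)) : input :=
  K *m (xj l j - xb s l) + v s l.
Definition Dj (l : nat) (j : 'I_(nvert d)) : 'M[R]_(dimx d, dimp d) :=
  Dmx (xj l j) (uj l j).
Definition dj (l : nat) (j : 'I_(nvert d)) : state :=
  A0 *m xj l j + B0 *m uj l j - z s l.+1.

Definition xhj (l : nat) (j : 'I_(nvert d)) : state :=
  zh s l + alh s l *: xv j.
Definition uhj (l : nat) (j : 'I_(nvert d)) : input :=
  K *m (xhj l j - xb s l) + v s l.
Definition Dhj (l : nat) (j : 'I_(nvert d)) : 'M[R]_(dimx d, dimp d) :=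
  Dmx (xhj l j) (uhj l j).
Definition dhj (l : nat) (j : 'I_(nvert d)) : state :=
  A0 *m xhj l j + B0 *m uhj l j - zh s l.+1.

Definition xtj (j : 'I_(nvert d)) : state := xt s + alt s *: xv j.
Definition utj (j : 'I_(nvert d)) : input := K *m (xtj j - xt s) + ut s.
Definition DNj (j : 'I_(nvert d)) : 'M[R]_(dimx d, dimp d) :=
  Dmx (xtj j) (utj j).
Definition dNj (j : 'I_(nvert d)) : state :=
  A0 *m xtj j + B0 *m utj j - xt s.

Definition upred_of (l : nat) (xp : state) : input :=
  K *m (xp - xb s l) + v s l.

Fixpoint xpred (l : nat) : state :=
  if l is l'.+1
  then Amx thb *m xpred l' + Bmx thb *m upred_of l' (xpred l')
  else x.

Definition upred (l : nat) : input := upred_of l (xpred l).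

Definition Hhat (l : nat) : 'M[R]_(rows_hat l, dimp d) :=
  col_mx Hth
    (\mxcol_(t < minn l (look_hor d)) - (Hw *m Dmx (xpred t) (upred t))).

Definition hhat (l : nat) : 'cV[R]_(rows_hat l) :=
  col_mx h
    (\mxcol_(t < minn l (look_hor d))
       (hw + Hw *m (A0 *m xpred t + B0 *m upred t - xpred t.+1))).

Record feasible : Prop := Feasible {
  f_state_input : forall l, (l < N)%N ->
    (F + G *m K) *m z s l + G *m v s l - G *m K *m xb s l + al s l *: fbar
      <=m ones;
  f_init : - (Hx *m z s 0) - al s 0 *: ones <=m - (Hx *m x);
  f_tube : forall j l, (l < N)%N ->
    Lam s l j *m h + Hx *m dj l j - al s l.+1 *: ones <=m - wbar /\
    Hx *m Dj l j = Lam s l j *m Hth;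
  f_init_hat : - (Hx *m zh s 0) - alh s 0 *: ones <=m - (Hx *m x);
  f_tube_hat : forall j l, (l < N)%N ->
    Lamh s l j *m hhat l + Hx *m dhj l j - alh s l.+1 *: ones <=m - wbar /\
    Hx *m Dhj l j = Lamh s l j *m Hhat l;
  f_ref : forall l, (l < N)%N ->
    Amx thb *m xb s l + Bmx thb *m ub s l = xb s l.+1 /\
    C *m xb s l = ref d (k + l);
  f_ref_end :
    (Amx thb - 1%:M) *m xb s N + Bmx thb *m ub s N = 0 /\
    C *m xb s N = ref d (k + N);
  f_term_state_input : F *m xt s + G *m ut s + alt s *: fbar <=m ones;
  f_term_tube : forall j,
    Lamt s j *m h + Hx *m dNj j - alt s *: ones <=m - wbar /\
    Hx *m DNj j = Lamt s j *m Hth;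
  f_term_link : z s N = xt s /\ al s N <= alt s;
  f_al_ge0 : forall l, (l <= N)%N -> 0 <= al s l;
  f_alh_ge0 : forall l, (l <= N)%N -> 0 <= alh s l;
  f_alt_ge0 : 0 <= alt s;
  f_Lam_ge0 : forall j l, (l < N)%N -> 0 <=m Lam s l j;
  f_Lamh_ge0 : forall j l, (l < N)%N -> 0 <=m Lamh s l j;
  f_Lamt_ge0 : forall j, 0 <=m Lamt s j
}.

Definition Xhat (l : nat) : set state :=
  [set zh s l + alh s l *: y | y in X0set].

Definition beta (t : nat) : R :=
  if (t <= T)%N then (1 - lambda_c d ^+ (T - t)) / (1 - lambda_c d) else 0.

(* The sets Xhat l are nonempty and compact, so that each sup is a maximum. *)
Definition cost : R :=
  \sum_(l < N)
    sup [set `|Qw d *m (C *m y - ref d (k + l))|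
             + `|Rw d *m (K *m (y - xb s l) + v s l - ub s l)|
        | y in Xhat l]
  + beta (k + N) *
    sup [set `|Qw d *m (C *m y - ref d (k + N))|
             + `|Rw d *m (K *m (y - xb s N) + ut s - ub s N)|
        | y in Xhat N].

End Candidate.

Definition problem_feasible : Prop := exists s, feasible s.

Definition optimal (s : decision) : Prop :=
  feasible s /\ forall s', feasible s' -> cost s <= cost s'.

End Problem.

Record trajectory := Trajectory {
  xs : nat -> state;
  us : nat -> input;
  hs : nat -> 'cV[R]_(rowsHth d);            (* h_(theta_k) *)
  ths : nat -> param;                        (* parameter estimates *)
  sols : nat -> decision                     (* computed solutions of P_k *)
}.

(* The computed solution at time k is only specified when P_k is feasible, so
   that this predicate does not presuppose feasibility.  The algorithm is fed
   with the actual state: the state is perfectly measured. *)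
Record closed_loop (thstar : param) (w : nat -> state) (x0 : state)
    (th0 : param) (tr : trajectory) : Prop := ClosedLoop {
  cl_x0 : xs tr 0 = x0;
  cl_h0 : hs tr 0 = hth d;
  cl_th0 : ths tr 0 = th0;
  cl_dynamics : forall k, (k <= T)%N ->
    xs tr k.+1 = Amx thstar *m xs tr k + Bmx thstar *m us tr k + w k;
  cl_h : forall k, (1 <= k <= T)%N -> forall i,
    is_max [set (Hth *m th) i 0 | th in
              polyhedron Hth (hs tr k.-1) `&` Delta (xs tr) (us tr) k]
           (hs tr k i 0);
  cl_th : forall k, (1 <= k <= T)%N ->
    estimate_optimal (hs tr k) (ths tr k.-1) (ths tr k);
  cl_sol : forall k, (k <= T)%N ->
    problem_feasible k (xs tr k) (hs tr k) (ths tr k) ->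
    optimal k (xs tr k) (hs tr k) (ths tr k) (sols tr k);
  cl_input : forall k, (k <= T)%N ->
    us tr k = K *m (xs tr k - xb (sols tr k) 0) + v (sols tr k) 0
}.

End Setup.

Arguments Theta {R} d.
Arguments Wset {R} d.
Arguments X0set {R} d.
Arguments Zset {R} d.

(* Main.v *)
(* A solution of P_k yields a candidate for P_(k+1).  By the rank conditions a
   reference trajectory exists for every estimate in Theta.  Shifting the state
   tube by one step, extending it by the terminal set, and correcting the
   inputs v by K times the change of reference leaves the inputs unchanged as
   functions of the state, so that the tube inclusions survive: their
   multipliers are nonnegative and the right-hand sides h_(theta_k) decrease.
   The new state lies in the first set of the shifted tube because the true
   parameter is never falsified, the state is a convex combination of the
   vertices of the old tube, and the dynamics are affine. *)
Require Import Defs.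
From HB Require Import structures.
From mathcomp Require Import all_boot all_order all_algebra.
From mathcomp Require Import mxtens lra.
From mathcomp Require Import all_classical all_reals all_analysis.
Import Order.TTheory GRing.Theory Num.Theory.
Import numFieldNormedType.Exports.
Local Open Scope classical_set_scope.
Local Open Scope ring_scope.

(** * Stacked vectors and Kronecker products *)

Lemma row_free_solve (R : fieldType) (a b : nat) (M : 'M[R]_(a, b))
    (y : 'cV[R]_a) : \rank M = a -> exists x, M *m x = y.
Proof.
move=> rkM; have /row_freeP[P MP] : row_free M by rewrite /row_free rkM.
by exists (P *m y); rewrite mulmxA MP mul1mx.
Qed.

Section StackedVectors.
Context (R : comNzRingType).

(** The index order is that of [tensmx], so a Kronecker product acts block by block. *)
Definition blk {N a : nat} (x : 'cV[R]_(N * a)) (l : 'I_N) : 'cV[R]_a :=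
  \col_i x (mxtens_index (l, i)) 0.

Definition stack {N a : nat} (f : 'I_N -> 'cV[R]_a) : 'cV[R]_(N * a) :=
  \col_i f (mxtens_unindex i).1 (mxtens_unindex i).2 0.

Lemma blk_stack (N a : nat) (f : 'I_N -> 'cV[R]_a) l : blk (stack f) l = f l.
Proof. by apply/colP => i; rewrite !mxE mxtens_indexK. Qed.

Lemma blkD (N a : nat) (x y : 'cV[R]_(N * a)) l :
  blk (x + y) l = blk x l + blk y l.
Proof. by apply/colP => i; rewrite !mxE. Qed.

Lemma blkN (N a : nat) (x : 'cV[R]_(N * a)) l : blk (- x) l = - blk x l.
Proof. by apply/colP => i; rewrite !mxE. Qed.

Lemma blk_tensmx (N N' a b : nat) (M : 'M[R]_(N, N')) (P : 'M[R]_(a, b))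
    (x : 'cV[R]_(N' * b)) l :
  blk (tensmx M P *m x) l = \sum_k M l k *: (P *m blk x k).
Proof.
apply/colP => i; rewrite summxE !mxE.
under [RHS]eq_bigr do rewrite !mxE big_distrr.
rewrite pair_bigA /= (reindex (@mxtens_index N' b)) /=; last first.
  by exists (@mxtens_unindex N' b) => k _;
    rewrite (mxtens_indexK, mxtens_unindexK).
by apply: eq_bigr => -[k j] _; rewrite tensmxE mxE mulrA.
Qed.

Lemma blk_tensmx1 (N a b : nat) (P : 'M[R]_(a, b)) (x : 'cV[R]_(N * b)) l :
  blk (tensmx 1%:M P *m x) l = P *m blk x l.
Proof.
rewrite blk_tensmx (bigD1 l) //= mxE eqxx scale1r big1 ?addr0 // => k kl.
by rewrite mxE eq_sym (negPf kl) scale0r.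
Qed.

End StackedVectors.

Arguments blk {R N a}.
Arguments stack {R N a}.

(** * Reference trajectories from the rank conditions *)

Section References.
Context (R : realType) (d : mpc_data R) (A2 : rank_assumption d).

Local Notation N := (pred_hor d).

(** Both ranks equal the number of rows, so both linear systems are solvable for every right-hand
    side. The equilibrium at time [N] is found first; the stacked system then yields a trajectory
    that ends in it. *)
Lemma reference_trajectory (th : 'cV[R]_(dimp d)) (r : nat -> 'cV[R]_(dimy d)) :
  Theta d th ->
  exists (xr : nat -> 'cV[R]_(dimx d)) (ur : nat -> 'cV[R]_(dimu d)),
    (forall l, (l < N)%N ->
       Amx th *m xr l + Bmx th *m ur l = xr l.+1 /\ C d *m xr l = r l) /\
    ((Amx th - 1%:M) *m xr N + Bmx th *m ur N = 0 /\ C d *m xr N = r N).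
Proof.
have [_ rk] := A2 => /rk[rkst rkN].
have [xuN] := row_free_solve _ _ _ _ (col_mx 0 (r N)) rkN.
rewrite -[xuN]vsubmxK mul_block_col mul0mx addr0 => /eq_col_mx.
set xN := usubmx _; set uN := dsubmx _ => -[dynN outN].
(* The last block row of [Ast] has no [- I] block, so its successor state [xN] has to come from the
   right-hand side. *)
pose last_state (l : 'I_N) := if l.+1 == N then xN else 0.
have [xu] := row_free_solve _ _ _ _
  (col_mx (stack last_state) (stack (fun l : 'I_N => r l)))
  (etrans rkst (mulnDr _ _ _)).
rewrite -[xu]vsubmxK mul_block_col mul0mx addr0 => /eq_col_mx.
set xst := usubmx _; set ust := dsubmx _ => -[dyn out].
(* The default value serves the index [N], which lies outside ['I_N]. *)
pose xr l := if insub l is Some l' then blk xst l' else xN.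
pose ur l := if insub l is Some l' then blk ust l' else uN.
exists xr, ur; split; last by rewrite /xr /ur insubF ?ltnn.
move=> l lN; rewrite {1 3}/xr /ur insubT /=; set l' := Ordinal lN.
split; last by move/(congr1 (blk ^~ l')): out;
  rewrite blk_tensmx1 blk_stack.
move/(congr1 (blk ^~ l')): dyn.
rewrite blkD mulmxBl blkD blkN !blk_tensmx1 blk_tensmx blk_stack /last_state /=.
rewrite /xr; case: eqP => [lN'|/eqP lN'].
  rewrite insubF ?lN' ?ltnn // big1 ?subr0 // => k _.
  by rewrite mxE lN' ltn_eqF ?scale0r.
have l1N : (l.+1 < N)%N by rewrite ltn_neqAle lN'.
rewrite insubT (bigD1 (Ordinal l1N)) //= mxE eqxx scale1r mul1mx big1 ?addr0.
  by move=> /eqP; rewrite addrAC subr_eq0 => /eqP.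
move=> k kl; rewrite mxE; suff /negPf-> : k != l.+1 :> nat by rewrite scale0r.
by apply: contra kl => /eqP kl; apply/eqP/val_inj.
Qed.

End References.

(** * One step of a tube and the constraints inside it *)

Section Tubes.
Context (R : realType) (d : mpc_data R) (standing : standing_assumptions d).

Local Notation state := 'cV[R]_(dimx d).
Local Notation input := 'cV[R]_(dimu d).
Local Notation xv := (@xvert R d).

(** For [a > 0] divide [x - zc] by [a]; for [a = 0] boundedness of [X0set d] forces [x = zc]. *)
Lemma tube_point (x zc : state) (a : R) : 0 <= a ->
  - (Hx d *m zc) - a *: ones <=m - (Hx d *m x) ->
  exists2 y, X0set d y & x = zc + a *: y.
Proof.
move=> a0 xz; have {xz} Hxz i : (Hx d *m (x - zc)) i 0 <= a.
  have := xz i 0; rewrite mulmxBr !mxE mulr1.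
  by rewrite -opprD lerN2 lerBlDl.
have [a_gt0|a_le0] := ltP 0 a.
  exists (a^-1 *: (x - zc)); last first.
    by rewrite scalerA divff ?gt_eqF// scale1r addrC subrK.
  move=> i j; rewrite (ord1 j) -scalemxAr mxE [leRHS]mxE.
  by rewrite mulrC ler_pdivrMr // mul1r.
have a_eq0 : a = 0 by apply/eqP; rewrite eq_le a0 a_le0.
(* For [a = 0] the difference spans a ray of the bounded set [X0set d]. *)
have ray t : 0 <= t -> X0set d (t *: (x - zc)).
  move=> t0 i j; rewrite (ord1 j) -scalemxAr mxE [leRHS]mxE.
  apply: le_trans (_ : t * a <= 1); first exact: ler_wpM2l.
  by rewrite a_eq0 mulr0.
exists 0; first by have := ray 0 (lexx _); rewrite scale0r.
rewrite scaler0 addr0; apply/eqP; rewrite -subr_eq0 -normr_eq0.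
have [M M0 bM] := pinfty_ex_gt0 (sa_X0 standing).
have {}bM y : X0set d y -> `|y| <= M by exact: bM.
rewrite eq_le normr_ge0 andbT leNgt; apply/negP => xz_gt0.
(* This scaling gives the point of the ray norm [M + 1], beyond the bound [M]. *)
have t_ge0 : 0 <= (M + 1) / `|x - zc| by rewrite divr_ge0 ?addr_ge0 // ltW.
have := bM _ (ray _ t_ge0); rewrite normrZ ger0_norm //.
by rewrite divfK ?gt_eqF // gerDl ler10.
Qed.

Lemma tube_convex (x zc : state) (a : R) : 0 <= a ->
  - (Hx d *m zc) - a *: ones <=m - (Hx d *m x) ->
  exists c : 'I_(nvert d) -> R,
    [/\ forall j, 0 <= c j, \sum_j c j = 1 &
        x = \sum_j c j *: (zc + a *: xv j)].
Proof.
move=> a0 /(tube_point _ _ _ a0)[y]; rewrite (sa_vertices standing).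
move=> [c [c0 c1 ->]] ->; exists c; split=> //.
under [RHS]eq_bigr do rewrite scalerDr.
rewrite big_split /= -scaler_suml c1 scale1r scaler_sumr; congr (_ + _).
by apply: eq_bigr => j _; rewrite !scalerA mulrC.
Qed.

Lemma dynamicsE (th : 'cV[R]_(dimp d)) (x : state) (u : input) :
  Amx th *m x + Bmx th *m u = A0 d *m x + B0 d *m u + Dmx x u *m th.
Proof.
rewrite /Amx /Bmx !mulmxDl addrACA; congr (_ + _).
rewrite !mulmx_suml -big_split /=; apply/colP => i.
rewrite summxE mxE; apply: eq_bigr => k _.
by rewrite -!scalemxAl -scalerDr mxE [in RHS]mxE mulrC.
Qed.

(** Weak duality: [Hx D th = L Hth th <= L h] for every [th] in the parameter set, since [L] is
    nonnegative. This bounds the successor of each vertex; convexity extends the bound to [x], and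
    the margin [wbar] absorbs [w]. *)
Lemma tube_step (h : 'cV[R]_(rowsHth d)) (th : 'cV[R]_(dimp d))
    (zc z' xr x w : state) (a a' : R) (v : input)
    (L : 'I_(nvert d) -> 'M[R]_(rowsHx d, rowsHth d))
    (y := fun j => zc + a *: xv j) (u := fun y => K d *m (y - xr) + v) :
  polyhedron (Hth d) h th -> Wset d w -> 0 <= a ->
  - (Hx d *m zc) - a *: ones <=m - (Hx d *m x) ->
  (forall j, 0 <=m L j) ->
  (forall j,
     L j *m h + Hx d *m (A0 d *m y j + B0 d *m u (y j) - z') - a' *: ones
       <=m - wbar d /\
     Hx d *m Dmx (y j) (u (y j)) = L j *m Hth d) ->
  - (Hx d *m z') - a' *: ones
    <=m - (Hx d *m (Amx th *m x + Bmx th *m u x + w)).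
Proof.
move=> th_h w_W a0 x_in L0 tube i j0; rewrite (ord1 j0) {j0}.
have [c [c0 c1 xE]] := tube_convex _ _ _ a0 x_in.
(* For fixed [th] the successor is affine in the state, with linear part [g] and offset [e]; weights
   of sum 1 therefore pass through it. *)
pose g := Hx d *m (Amx th + Bmx th *m K d).
pose e := Hx d *m (Bmx th *m (v - K d *m xr)) - Hx d *m z'.
have gE s : Hx d *m (Amx th *m s + Bmx th *m u s) - Hx d *m z' = g *m s + e.
  rewrite /g /e /u; move: (Amx th) (Bmx th) => A B.
  rewrite addrA -mulmxA -mulmxDr; congr (Hx d *m _ - _).
  rewrite mulmxDl -mulmxA -addrA -mulmxDr mulmxBr.
  by rewrite addrAC addrA.
have Hy j : (g *m y j + e) i 0 <= a' - wbar d i 0.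
  have [+ DL] := tube j => /(_ i 0).
  rewrite -gE dynamicsE [Hx d *m (_ + Dmx _ _ *m th)]mulmxDr.
  rewrite (mulmxA _ (Dmx _ _)) DL -(mulmxA (L j)) mulmxBr.
  have LH : (L j *m (Hth d *m th)) i 0 <= (L j *m h) i 0.
    rewrite !mxE; apply: ler_sum => k _.
    by apply: ler_wpM2l; [have := L0 j i k; rewrite mxE | exact: th_h].
  move: LH; set LHth := L j *m (Hth d *m th); set Lh := L j *m h.
  rewrite !mxE mulr1; lra.
have Hx_step : (g *m x + e) i 0 <= a' - wbar d i 0.
  have -> : g *m x + e = \sum_j c j *: (g *m y j + e).
    under eq_bigr do rewrite scalerDr.
    rewrite big_split /= -scaler_suml c1 scale1r {1}xE mulmx_sumr.
    by congr (_ + e); apply: eq_bigr => j _; rewrite -scalemxAr.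
  rewrite summxE -[leRHS]mul1r -c1 mulr_suml; apply: ler_sum => j _.
  by rewrite mxE ler_wpM2l.
have Hww : (Hx d *m w) i 0 <= wbar d i 0.
  by have [_] := sa_wbar standing i; apply; exists w.
move: Hx_step Hww; rewrite -gE [Hx d *m (_ + w)]mulmxDr.
move: (Hx d *m (_ + _)) (Hx d *m z') (Hx d *m w) => f Hz' Hw.
rewrite !mxE mulr1; lra.
Qed.

Lemma state_input_constraint (zc xr x : state) (a : R) (v : input) : 0 <= a ->
  - (Hx d *m zc) - a *: ones <=m - (Hx d *m x) ->
  (F d + G d *m K d) *m zc + G d *m v - G d *m K d *m xr + a *: fbar d
    <=m ones ->
  F d *m x + G d *m (K d *m (x - xr) + v) <=m ones.
Proof.
move=> a0 /(tube_point _ _ _ a0)[y yX ->] con i j; rewrite (ord1 j).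
apply: le_trans (con i 0).
set g := F d + G d *m K d.
have -> : F d *m (zc + a *: y) + G d *m (K d *m (zc + a *: y - xr) + v) =
    g *m zc + G d *m v - G d *m K d *m xr + a *: (g *m y).
  rewrite -(addrA (g *m zc)) [RHS]addrAC scalemxAr -mulmxDr {}/g.
  rewrite mulmxDl [G d *m (_ + v)]mulmxDr !mulmxBr !mulmxA -!addrA.
  by congr (_ + (_ + _)); rewrite addrC.
have := sa_fbar standing i => -[_ /(_ _ (ex_intro2 _ _ y yX erefl)) gy].
by rewrite mxE [leRHS]mxE lerD2l mxE [leRHS]mxE ler_wpM2l.
Qed.

End Tubes.

(** * The shifted candidate and its feasibility *)

Section Shift.
Context (R : realType) (d : mpc_data R) (standing : standing_assumptions d).

Local Notation state := 'cV[R]_(dimx d).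
Local Notation input := 'cV[R]_(dimu d).
Local Notation N := (pred_hor d).

Lemma tube_weaken (L : 'M[R]_(rowsHx d, rowsHth d)) (h h' : 'cV[R]_(rowsHth d))
    (y b : 'cV[R]_(rowsHx d)) (a a' : R) : 0 <=m L -> h' <=m h -> a <= a' ->
  L *m h + y - a *: ones <=m b -> L *m h' + y - a' *: ones <=m b.
Proof.
move=> L0 hh' aa' Lh i j; apply: le_trans (Lh i j).
have : (L *m h') i j <= (L *m h) i j.
  rewrite !mxE; apply: ler_sum => k _; apply: ler_wpM2l; last exact: hh'.
  by have := L0 i k; rewrite mxE.
move: (L *m h') (L *m h) => Lh1 Lh2.
by rewrite !mxE !mulr1; lra.
Qed.

Lemma recentered_input (y r r' : state) (u : input) :
  K d *m (y - r') + (u + K d *m (r' - r)) = K d *m (y - r) + u.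
Proof. by rewrite addrCA -mulmxDr addrA subrK addrC. Qed.

Lemma recentered_constraint (y r r' : state) (u : input) :
  (F d + G d *m K d) *m y + G d *m (u + K d *m (r' - r)) - G d *m K d *m r'
  = (F d + G d *m K d) *m y + G d *m u - G d *m K d *m r.
Proof.
rewrite mulmxDr !mulmxBr !mulmxA -!addrA; congr (_ + (_ + _)).
by rewrite addrC subrK.
Qed.

(* The inputs, as functions of the state, are those of the previous solution
   shifted by one step and extended by its terminal feedback; only the
   references are recomputed.  Ignoring the rows of [Hhat] that come from the
   predicted measurements makes the tube itself a predicted tube. *)
Section Candidate.
Context (s : decision d) (xr : nat -> state) (ur : nat -> input).

Let zs l := if (l.+1 < N)%N then z s l.+1 else xt s.
Let als l := if (l.+1 < N)%N then al s l.+1 else alt s.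
Let vs l := if (l.+1 < N)%N then v s l.+1 + K d *m (xr l - xb s l.+1)
            else ut s + K d *m (xr l - xt s).
Let Lams l := if (l.+1 < N)%N then Lam s l.+1 else Lamt s.

Definition shifted : decision d :=
  Decision zs zs als als vs xr ur (xt s) (ut s) (alt s) Lams
    (fun l j => row_mx (Lams l j) 0) (Lamt s).

End Candidate.

Section ShiftedFeasible.
Context (k : nat) (x x' : state) (h h' : 'cV[R]_(rowsHth d))
  (thb thb' : 'cV[R]_(dimp d)) (s : decision d)
  (xr : nat -> state) (ur : nat -> input).
Hypotheses (fs : feasible k x h thb s) (hh' : h' <=m h).

Lemma shifted_al_ge0 l : 0 <= al (shifted s xr ur) l.
Proof.
rewrite /=; case: ifP => [lN|_]; last exact: f_alt_ge0 fs.
by apply: f_al_ge0 fs _ _; exact: ltnW.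
Qed.

Lemma shifted_Lam_ge0 j l : 0 <=m Lam (shifted s xr ur) l j.
Proof.
rewrite /=; case: ifP => [lN|_]; last exact: f_Lamt_ge0 fs _.
exact: f_Lam_ge0 fs _ _ lN.
Qed.

Lemma shifted_state_input l : (l < N)%N ->
  let s' := shifted s xr ur in
  (F d + G d *m K d) *m z s' l + G d *m v s' l - G d *m K d *m xb s' l
    + al s' l *: fbar d <=m ones.
Proof.
move=> lN /=; case: ifP => [l1N|_]; rewrite recentered_constraint.
  exact: f_state_input fs _ l1N.
(* The terminal feedback is centred at [xt s] itself, so the two terms [G K xt] cancel. *)
by rewrite mulmxDl (addrAC (F d *m _)) addrK; exact: f_term_state_input fs.
Qed.

(** Three cases. For [l + 2 < N] this is an old tube step. For [l + 2 = N] the old step ends in the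
    set of index [N], which the terminal link places inside the terminal set. For [l + 1 = N] it is
    invariance of the terminal set. *)
Lemma shifted_tube j l : (l < N)%N ->
  let s' := shifted s xr ur in
  Lam s' l j *m h' + Hx d *m dj s' l j - al s' l.+1 *: ones <=m - wbar d /\
  Hx d *m Dj s' l j = Lam s' l j *m Hth d.
Proof.
move=> lN s'; have L0 := shifted_Lam_ge0 j l; move: L0.
rewrite /Dj /dj /uj /xj /=; case: ifP => [l1N|lN'] L0; last first.
  have -> : (l.+2 < N)%N = false by apply: contraFF lN'; exact: ltnW.
  rewrite recentered_input; have [tube ->] := f_term_tube fs j.
  by split=> //; exact: tube_weaken tube.
rewrite recentered_input; have [tube ->] := f_tube fs j l1N.
split=> //; move: tube; rewrite /dj; have [zN alN] := f_term_link fs.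
case: ifP => [_|/negbT l2N]; first exact: tube_weaken.
have -> : l.+2 = N by apply/eqP; rewrite eqn_leq l1N leqNgt.
by rewrite zN; exact: tube_weaken.
Qed.

End ShiftedFeasible.

Lemma shift_feasible (k : nat) (x x' : state) (h h' : 'cV[R]_(rowsHth d))
    (thb thb' : 'cV[R]_(dimp d)) (s : decision d) :
  rank_assumption d -> Theta d thb' -> feasible k x h thb s -> h' <=m h ->
  - (Hx d *m z s 1) - al s 1 *: ones <=m - (Hx d *m x') ->
  problem_feasible k.+1 x' h' thb'.
Proof.
move=> A2 thb'_in fs hh' x'_in.
(* Horizon at least 2: the candidate's first set is then the old set of index 1, not the terminal
   one. *)
have N1 : (1 < N)%N by have /andP[] := sa_horizons standing; exact: leq_trans.
have [xr [ur [ref_dyn ref_end]]] :=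
  reference_trajectory R d A2 thb' (fun l => ref d (k.+1 + l)) thb'_in.
exists (shifted s xr ur).
have init : - (Hx d *m z (shifted s xr ur) 0) - al (shifted s xr ur) 0 *: ones
    <=m - (Hx d *m x') by rewrite /= N1.
split=> //.
- by move=> l lN; exact: shifted_state_input fs _ lN.
- by move=> j l lN; exact: shifted_tube fs hh' _ _ lN.
- move=> j l lN; rewrite !mul_row_col !mul0mx !addr0.
  exact: shifted_tube fs hh' _ _ lN.
- exact: f_term_state_input fs.
- move=> j; have [tube ->] := f_term_tube fs j; split=> //.
  by apply: tube_weaken tube => //; exact: f_Lamt_ge0 fs _.
(* At index [N] the candidate tube is the terminal set itself. *)
- by rewrite /= ltnNge leqnSn.
- by move=> l _; exact: shifted_al_ge0 fs _.
- by move=> l _; exact: shifted_al_ge0 fs _.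
- exact: f_alt_ge0 fs.
- by move=> j l _; exact: shifted_Lam_ge0 fs _ _.
- move=> j l lN i c; rewrite [leRHS]mxE.
  case: splitP => c' _; last by rewrite !mxE.
  by have := shifted_Lam_ge0 _ _ _ _ _ xr ur fs j l i c'; rewrite !mxE.
- exact: f_Lamt_ge0 fs.
Qed.

End Shift.

(** * Parameter sets and estimates along the closed loop *)

Section ClosedLoop.
Context (R : realType) (d : mpc_data R) (thstar : 'cV[R]_(dimp d))
  (w : nat -> 'cV[R]_(dimx d)) (x0 : 'cV[R]_(dimx d)) (th0 : 'cV[R]_(dimp d))
  (tr : trajectory d).
Hypotheses (thstar_in : Theta d thstar) (w_in : forall k, Wset d (w k))
  (th0_in : Theta d th0) (tr_cl : closed_loop thstar w x0 th0 tr).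

(** Inserting the true dynamics reduces each inequality to [Hw w_i <= hw]. *)
Lemma true_param_in_Delta k : (k <= ctrl_hor d)%N ->
  Delta (xs tr) (us tr) k thstar.
Proof.
move=> kT i /andP[_ ik]; have iT := ltnW (leq_trans ik kT).
rewrite (cl_dynamics tr_cl iT) dynamicsE.
move: (A0 d *m _ + _) (Dmx _ _) => y D.
rewrite -(addrA y) opprD addrA subrr add0r opprD mulmxDr !mulmxN mulNmx -mulmxA.
move=> a b; have := w_in i a b.
move: (Hw d *m w i) (Hw d *m _) => Hww HD; rewrite !mxE; lra.
Qed.

(** The maximum is attained at a point of the previous parameter set. *)
Lemma hs_antitone k : (k < ctrl_hor d)%N -> hs tr k.+1 <=m hs tr k.
Proof.
move=> kT i j; rewrite (ord1 j).
by have [[th [th_in _] <-] _] := cl_h tr_cl (kT : (1 <= k.+1 <= _)%N) i.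
Qed.

Lemma hs_le_hth k : (k <= ctrl_hor d)%N -> hs tr k <=m hth d.
Proof.
elim: k => [_|k IHk kT] i j; first by rewrite (cl_h0 tr_cl).
exact: le_trans (hs_antitone _ kT i j) (IHk (ltnW kT) i j).
Qed.

Lemma true_param_in_set k : (k <= ctrl_hor d)%N ->
  polyhedron (Hth d) (hs tr k) thstar.
Proof.
elim: k => [_|k IHk kT]; first by rewrite (cl_h0 tr_cl).
move=> i j; rewrite (ord1 j).
have [_] := cl_h tr_cl (kT : (1 <= k.+1 <= _)%N) i; apply.
exists thstar => //.
by split; [exact: IHk (ltnW kT) | exact: true_param_in_Delta].
Qed.

(** The estimate is the centre of a ball of radius [rc >= 0] inside the current set, which is
    contained in [Theta d]. *)
Lemma estimate_in_Theta k : (k <= ctrl_hor d)%N -> Theta d (ths tr k).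
Proof.
case: k => [_|k kT]; first by rewrite (cl_th0 tr_cl).
have [rc [rc0 rcP] _] := cl_th tr_cl (kT : (1 <= k.+1 <= _)%N).
move=> i j; rewrite (ord1 j); apply: le_trans (hs_le_hth _ kT i 0).
by apply: le_trans (rcP i); rewrite lerDl mulr_ge0 ?sqrtr_ge0.
Qed.

End ClosedLoop.

Theorem theorem1 (R : realType) (d : mpc_data R)
  (standing : standing_assumptions d)
  (A2 : rank_assumption d)
  (A3 : stability_assumption d)
  (A4 : contraction_assumption d)
  (x0 : 'cV[R]_(dimx d)) (th0 : 'cV[R]_(dimp d))
  (th0_in : Theta d th0)
  (P0_feasible : problem_feasible 0 x0 (hth d) th0)
  (thstar : 'cV[R]_(dimp d)) (thstar_in : Theta d thstar)
  (w : nat -> 'cV[R]_(dimx d)) (w_in : forall k, Wset d (w k))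
  (tr : trajectory d) (tr_cl : closed_loop thstar w x0 th0 tr) :
  (forall k, (1 <= k <= ctrl_hor d)%N ->
     problem_feasible k (xs tr k) (hs tr k) (ths tr k)) /\
  (forall k, (k <= ctrl_hor d)%N ->
     F d *m xs tr k + G d *m us tr k <=m ones).
Proof.
have N0 : (0 < pred_hor d)%N.
  by have /andP[/ltnW] := sa_horizons standing; exact: leq_trans.
have feas k : (k <= ctrl_hor d)%N ->
    problem_feasible k (xs tr k) (hs tr k) (ths tr k).
  elim: k => [_|k IHk kT].
    by rewrite (cl_x0 tr_cl) (cl_h0 tr_cl) (cl_th0 tr_cl).
  (* [cl_sol] speaks of the computed solution only once feasibility is known; the induction
     hypothesis supplies it. *)
  have [fs _] := cl_sol tr_cl (ltnW kT) (IHk (ltnW kT)).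
  apply: (shift_feasible _ _ standing _ _ _ _ _ _ _ _ A2 _ fs).
  - exact: estimate_in_Theta th0_in tr_cl _ kT.
  - exact: hs_antitone tr_cl _ kT.
  rewrite (cl_dynamics tr_cl (ltnW kT)) (cl_input tr_cl (ltnW kT)).
  apply: (tube_step _ _ standing _ _ _ _ _ _ _ _ _ _ (Lam (sols tr k) 0)
            _ _ _ (f_init fs)).
  - exact: true_param_in_set thstar_in w_in tr_cl _ (ltnW kT).
  - exact: w_in.
  - exact: f_al_ge0 fs _ _.
  - by move=> j; exact: (f_Lam_ge0 fs j N0).
  - by move=> j; exact: (f_tube fs j N0).
split=> k; first by move=> /andP[_]; exact: feas.
move=> kT; have [fs _] := cl_sol tr_cl kT (feas _ kT).
rewrite (cl_input tr_cl kT).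
apply: (state_input_constraint _ _ standing _ _ _ _ _ _ (f_init fs)).
  exact: f_al_ge0 fs _ _.
exact: f_state_input fs _ N0.
Qed.
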